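(* Let $I\subset R=\mathbf{k}[x_1,\dots,x_n]$ be a monomial ideal, $MVT(I)$ a Mayer-Vietoris tree of $I$, and $a\in\mathbb{N}^n$. If $x^{a}$ appears only once as a generator of a relevant node in $MVT(I)$ (i.e. there is exactly one relevant node of which $x^a$ is a minimal generator), then there exists exactly one generator in $H_*(\mathbb{K}(I))$ which has multidegree $a$, i.e. $\sum_i\dim_{\mathbf{k}}H_{i,a}(\mathbb{K}(I))=1$.
   Context: $\mathbf{k}$ is a field of characteristic $0$, $R=\mathbf{k}[x_1,\dots,x_n]$ with its $\mathbb{N}^n$-grading. Monomial ideals are nonzero. Koszul homology: let $\mathcal{V}$ be the $\mathbf{k}$-vector space with basis $x_1,\dots,x_n$. $\mathbb{K}(I)$ is the complex with modules $I\otimes_{\mathbf{k}}\wedge^i\mathcal{V}$ and differential $\partial(m\otimes x_{j_1}\wedge\cdots\wedge x_{j_i})=\sum_{l=1}^i(-1)^{l+1}x_{j_l}m\otimes x_{j_1}\wedge\cdots\wedge\widehat{x_{j_l}}\wedge\cdots\wedge x_{j_i}$. It is $\mathbb{N}^n$-graded (the multidegree of $x^\mu\otimes x_{j_1}\wedge\cdots\wedge x_{j_i}$ is $\mu+e_{j_1}+\cdots+e_{j_i}$), and $H_{i,a}(\mathbb{K}(I))\cong \mathrm{Tor}^R_{i,a}(I,\mathbf{k})$ is the multidegree-$a$ part of its $i$-th homology. Mayer-Vietoris trees: a Mayer-Vietoris tree $MVT(I)$ of $I$ is a rooted binary tree whose nodes are (labelled by) monomial ideals, with root $I$. Whenever a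 node $J$ has minimal monomial generating set $\{m_1,\dots,m_s\}$ with $s\geq 2$, one minimal generator (the pivot monomial) is chosen, the choice being arbitrary at each node; numbering so that the pivot is $m_s$, the node $J$ has exactly two children: the left child $\tilde J=\langle m_1,\dots,m_{s-1}\rangle\cap\langle m_s\rangle=\langle \mathrm{lcm}(m_1,m_s),\dots,\mathrm{lcm}(m_{s-1},m_s)\rangle$ and the right child $J'=\langle m_1,\dots,m_{s-1}\rangle$. Nodes with a single minimal generator are leaves. Positions: the root has position $1$; if a node has position $p$, its left child has position $2p$ and its right child position $2p+1$. A node is relevant if its position is $1$ or even. *)

(* Defs.v *)
From HB Require Import structures.
From mathcomp Require Import all_boot all_algebra.
From mathcomp Require Import finmap.
From mathcomp Require Import mpoly.

Set Implicit Arguments.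
Unset Strict Implicit.
Unset Printing Implicit Defensive.

Import GRing.Theory.
Local Open Scope ring_scope.

Section MonomialIdeals.
Variables (k : fieldType) (n : nat).
Implicit Types (I J : {mpoly k[n]} -> Prop) (G H : {fset 'X_{1..n}}).

(* The ideal generated by the monomials whose exponent is in X. *)
Definition mon_gen (X : 'X_{1..n} -> Prop) : {mpoly k[n]} -> Prop := fun p =>
  exists s : seq ({mpoly k[n]} * 'X_{1..n}),
    (forall u, u \in s -> X u.2) /\ p = \sum_(u <- s) u.1 * 'X_[u.2].

Definition monomial_ideal I : Prop :=
  (exists X : 'X_{1..n} -> Prop, forall p, I p <-> mon_gen X p) /\
  (exists p, I p /\ p != 0).

Definition mon_ideal G : {mpoly k[n]} -> Prop := mon_gen (fun m => m \in G).

Definition generates G I : Prop := forall p, I p <-> mon_ideal G p.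

Definition min_gens I G : Prop :=
  generates G I /\
  forall H, (H `<=` G)%fset -> generates H I -> H = G.

Definition min_generator I (m : 'X_{1..n}) : Prop :=
  exists2 G, min_gens I G & m \in G.

(* Mayer-Vietoris trees with root J, the second constructor recording the
   pivot m chosen at J; the subtrees are the left one (the intersection) and
   then the right one. *)
Inductive mvt (J : {mpoly k[n]} -> Prop) : Type :=
| mvt_leaf (m : 'X_{1..n}) of min_gens J [fset m]%fset
| mvt_node (G : {fset 'X_{1..n}}) (m : 'X_{1..n})
    of min_gens J G & (1 < #|` G|)%N & m \in G
    & mvt (fun p => mon_ideal (G `\ m)%fset p /\ mon_ideal [fset m]%fset p)
    & mvt (mon_ideal (G `\ m)%fset).

(* [node_from q T p L]: when the root of T is given position q, the tree T has
   a node at position p, and that node is labelled by L. *)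
Fixpoint node_from (q : nat) J (T : mvt J) (p : nat)
    (L : {mpoly k[n]} -> Prop) : Prop :=
  match T with
  | mvt_leaf _ _ => p = q /\ L = J
  | mvt_node _ _ _ _ _ Tl Tr =>
      [\/ p = q /\ L = J,
          node_from (2 * q)%N Tl p L
        | node_from (2 * q + 1)%N Tr p L]
  end.

Definition mvt_node_at J (T : mvt J) := node_from 1 T.

Definition relevant (p : nat) : bool := (p == 1%N) || ~~ odd p.

End MonomialIdeals.

Arguments mon_ideal {k n} G _.

Section Koszul.
Variables (k : fieldType) (n : nat) (I : {mpoly k[n]} -> Prop).

(* Elements of R (x) /\V in coordinates: f stands for the sum over S of
   f S (x) e_S, where e_S = x_{j_1} /\ ... /\ x_{j_i} for
   S = {j_1 < ... < j_i}. *)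
Definition kchain := {ffun {set 'I_n} -> {mpoly k[n]}}.

Definition ktensor (p : {mpoly k[n]}) (S : {set 'I_n}) : kchain :=
  [ffun U => if U == S then p else 0].

(* If j is the l-th element of S in increasing order, then l - 1 elements of S
   are smaller than j, and (-1)^(l+1) = (-1)^(l-1). *)
Definition kdiff (f : kchain) : kchain :=
  \sum_(S : {set 'I_n}) \sum_(j in S)
    ktensor ((-1) ^+ #|[set t in S | (t < j)%N]| * 'X_j * f S) (S :\ j).

Definition koszul (i : nat) (f : kchain) : Prop :=
  forall S, I (f S) /\ (#|S| != i -> f S = 0).

Definition kmultideg (a : 'X_{1..n}) (f : kchain) : Prop :=
  forall S m, m \in msupp (f S) -> (m + \sum_(j in S) U_(j))%MM = a.

Definition kcycle (i : nat) (f : kchain) : Prop :=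
  koszul i f /\ kdiff f = 0.

Definition kboundary (i : nat) (f : kchain) : Prop :=
  exists g, koszul i.+1 g /\ f = kdiff g.

End Koszul.

(* [quot_dim Z B d]: for linear subspaces B of Z, the quotient Z/B has dimension
   d, i.e. the classes of some d vectors of Z form a basis of Z/B. *)
Definition quot_dim (k : fieldType) (V : lmodType k) (Z B : V -> Prop)
    (d : nat) : Prop :=
  exists z : 'I_d -> V, (forall r, Z (z r)) /\
    forall v, Z v ->
      exists! c : {ffun 'I_d -> k}, B (v - \sum_(r < d) c r *: z r).

Definition koszul_homology_dim (k : fieldType) (n : nat)
    (I : {mpoly k[n]} -> Prop) (i : nat) (a : 'X_{1..n}) (d : nat) : Prop :=
  quot_dim (V := kchain k n)
    (fun f => kcycle I i f /\ kmultideg a f)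
    (fun f => kboundary I i f /\ kmultideg a f) d.

(* Main.v *)
Require Import Defs.
From HB Require Import structures.
From mathcomp Require Import all_boot all_algebra.
From mathcomp Require Import finmap.
From mathcomp Require Import mpoly.
From mathcomp Require Import zify.

(** In multidegree a, the Koszul complex of a monomial ideal J has one basis
    element for each set S of variables such that the product x^S of these
    variables divides x^a and x^(a - S) lies in J.  These sets form a family
    closed under taking subsets, and the differential is the simplicial
    boundary.  So the total homology of J in multidegree a is the total
    homology h of a simplicial complex (counting the empty set as a face), which
    is finite-dimensional linear algebra: h = #faces - 2 * rank of the boundary
    ([hsum_brank]).  In particular h and the number of faces have the same
    parity, that is, h is congruent to the Euler characteristic modulo 2.

    If m is the pivot of J, the faces for J are the union of those for J' (the
    right child) and those for the ideal of m, and the faces for the left child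
    are their intersection.  Hence h(J) is at most the sum of the three other
    values of h, as in the Mayer-Vietoris sequence, and has the same parity as
    that sum ([hsum_mayer_vietoris]).  The principal ideal of m contributes 1 if
    m = a, and 0 otherwise, because then its faces form a cone or are absent
    ([hsum_principal]).  By induction on the tree, h(I) is at most the number
    rho of pivots and leaf generators equal to a, with the same parity
    ([hsum_pivot_count]).

    Finally rho is also the number of relevant nodes of which x^a is a minimal
    generator ([size_positions]): starting from such a node, a remains a
    generator along the branch of right children until it is removed as a
    pivot or a leaf is reached, and this branch meets no other relevant node.
    So rho = 1 by hypothesis, and h(I) is odd and at most 1, hence equal to 1.
    The theorem also wants the dimension in each homological degree; that part
    is the translation of polynomial chains of multidegree a into functions on
    sets ([koszul_homology_hdim]). *)

Set Implicit Arguments.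
Unset Strict Implicit.
Unset Printing Implicit Defensive.

Import GRing.Theory.
Local Open Scope ring_scope.

(** * Homology of families of sets *)

(** Chains on all subsets of the n variables; the complex of a family of sets
    is the subspace of the chains supported on it, so that unions and
    intersections of families become sums and intersections of subspaces of
    one ambient space. *)
Definition schain (k : fieldType) (n : nat) := {ffun {set 'I_n} -> k^o}.

Section SetComplex.
Variables (k : fieldType) (n : nat).
Implicit Types (S U A : {set 'I_n}) (X Y : {set {set 'I_n}}) (v w : schain k n).

HB.instance Definition _ := Vector.on (schain k n).

Definition bsign (j : 'I_n) (S : {set 'I_n}) : k := (-1) ^+ #|[set t in S | (t < j)%N]|.

Lemma bsignU1_ge (j l : 'I_n) S : (j <= l)%N -> bsign j (l |: S) = bsign j S.
Proof.
move=> jl; rewrite /bsign; congr (_ ^+ #|pred_of_set _|); apply/setP=> t; rewrite !inE.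
by case: eqP => [->|]//=; rewrite ltnNge jl /= andbF.
Qed.

Lemma bsignU1_lt (j l : 'I_n) S : (l < j)%N -> l \notin S -> bsign j (l |: S) = - bsign j S.
Proof.
move=> lj lS; rewrite /bsign.
have -> : [set t in l |: S | (t < j)%N] = l |: [set t in S | (t < j)%N].
  by apply/setP=> t; rewrite !inE; case: eqP => [->|].
by rewrite cardsU1 inE (negbTE lS) /= exprS mulN1r.
Qed.

(** The boundary in coordinates: the coefficient at U collects the faces from
    which U is obtained by deleting one element j. *)
Definition bdry (v : schain k n) : schain k n :=
  [ffun U : {set 'I_n} => \sum_(j | j \notin U) bsign j U * v (j |: U)].

Lemma bdry_is_linear : linear bdry.
Proof.
move=> c v w; apply/ffunP=> U; rewrite !ffunE scaler_sumr -big_split /=.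
apply: eq_bigr => j _; rewrite !ffunE mulrDr; congr (_ + _).
by rewrite /GRing.scale /= mulrCA.
Qed.

HB.instance Definition _ :=
  GRing.isLinear.Build k (schain k n) (schain k n) *:%R bdry bdry_is_linear.

Definition bdryL : 'End(schain k n) := linfun bdry.

Lemma bdryLE v U : bdryL v U = \sum_(j | j \notin U) bsign j U * v (j |: U).
Proof. by rewrite lfunE ffunE. Qed.

(** Deleting j and l in either order reaches the same set, with opposite signs. *)
Lemma bdryL_sq v : bdryL (bdryL v) = 0.
Proof.
apply/ffunP=> U; rewrite bdryLE ffunE.
pose F (j l : 'I_n) := if (j \notin U) && (l \notin U) then
  bsign j U * (bsign l U * v (l |: (j |: U))) else 0.
have FC j l : F j l = F l j.
  rewrite /F andbC; case: ifP => // _.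
  by rewrite setUCA mulrCA.
(* The presence of j changes the sign of l exactly when j < l, so the ordered pairs
   with l < j and those with j < l give two opposite sums; antisymmetry of the
   whole sum would only show that its double vanishes. *)
have -> : \sum_(j | j \notin U) bsign j U * bdryL v (j |: U) =
  \sum_(j < n) (\sum_(l < n | (l < j)%N) F j l - \sum_(l < n | (j < l)%N) F j l).
  rewrite big_mkcond; apply: eq_bigr => j _.
  case: ifP => jU; last first.
    by rewrite !big1 ?subr0 // => l _; rewrite /F jU.
  rewrite bdryLE mulr_sumr [LHS](bigID (fun l : 'I_n => (l < j)%N)) /=; congr (_ + _).
    rewrite big_mkcondl; apply: eq_bigr => l lj; rewrite /F jU !inE negb_or.
    rewrite -(inj_eq val_inj) /= ltn_eqF //=; case: ifP => // lU.
    by rewrite bsignU1_ge // ltnW.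
  rewrite -sumrN [RHS]big_mkcond [LHS]big_mkcond; apply: eq_bigr => l _.
  rewrite /F jU !inE negb_or -(inj_eq val_inj) /= -leqNgt.
  case: ltngtP => //= jl; rewrite ?andbF // ?andbT.
  case: ifP => // lU; last by rewrite oppr0.
  by rewrite bsignU1_lt // mulNr mulrN.
rewrite big_split /= sumrN [X in _ - X](exchange_big_dep predT) //=.
by apply/eqP; rewrite subr_eq0; apply/eqP; do 2!apply: eq_bigr => ? _.
Qed.

Definition delta A : schain k n := [ffun U => (U == A)%:R].

Definition supp_space X : {vspace schain k n} :=
  <<[seq delta A | A <- enum X]>>%VS.

Lemma supp_spaceP X v :
  reflect (forall S, S \notin X -> v S = 0) (v \in supp_space X).
Proof.
apply: (iffP idP) => [|vX].
  move=> /coord_span -> S SX; rewrite sum_ffunE big1 // => i _.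
  have lti : (i < size (enum X))%N by rewrite -cardE.
  rewrite ffunE (nth_map set0) // ffunE.
  case: eqP => [E|_]; last by rewrite scaler0.
  by move: SX; rewrite E -mem_enum mem_nth.
have -> : v = \sum_(S in X) v S *: delta S.
  apply/ffunP=> U; rewrite sum_ffunE; under eq_bigr do rewrite !ffunE.
  case UX : (U \in X); last first.
    rewrite vX ?UX // big1 // => S SX; case: eqP => [E|_]; last by rewrite scaler0.
    by rewrite E SX in UX.
  rewrite (bigD1 U) //= eqxx big1 ?addr0; last first.
    by move=> S /andP[_ /negbTE]; rewrite eq_sym => ->; rewrite scaler0.
  by rewrite /GRing.scale /= mulr1.
apply: memv_suml => S SX; apply: memvZ; apply: memv_span.
by apply/mapP; exists S; rewrite ?mem_enum.
Qed.

Lemma dim_supp_space X : \dim (supp_space X) = #|X|.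
Proof.
rewrite /supp_space cardE -(size_map delta).
apply/eqP; rewrite -[_ == _]/(free _).
set s := map _ _; apply/(@freeP _ _ _ (in_tuple s)) => c c0 i.
have lt l : (l < size s -> l < size (enum X))%N by rewrite size_map.
have := congr1 (fun v : schain k n => v (nth set0 (enum X) i)) c0.
rewrite sum_ffunE ffunE (bigD1 i) //= big1 ?addr0 => [|l li].
  by rewrite ffunE (nth_map set0) ?lt // ffunE eqxx /GRing.scale /= mulr1.
rewrite ffunE (nth_map set0) ?lt // ffunE nth_uniq ?enum_uniq ?lt //.
by rewrite eq_sym (inj_eq val_inj) (negbTE li) scaler0.
Qed.

Lemma supp_spaceU X Y : supp_space (X :|: Y) = (supp_space X + supp_space Y)%VS.
Proof.
apply/eqP; rewrite eqEsubv; apply/andP; split; last first.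
  by apply/subvP=> _ /memv_addP[u /supp_spaceP hu [w /supp_spaceP hw ->]];
    apply/supp_spaceP => S; rewrite !inE negb_or => /andP[SX SY]; rewrite ffunE hu ?hw ?addr0.
apply/subvP=> v /supp_spaceP hv; apply/memv_addP.
exists [ffun S => if S \in X then v S else 0].
  by apply/supp_spaceP => S /negbTE SX; rewrite ffunE SX.
exists [ffun S => if S \in X then 0 else v S].
  apply/supp_spaceP => S /negbTE SY; rewrite ffunE; case: ifP => // SX.
  by apply: hv; rewrite inE SX SY.
by apply/ffunP=> S; rewrite !ffunE; case: ifP => _; rewrite ?addr0 ?add0r.
Qed.

Definition down_closed X := forall S U, S \in X -> U \subset S -> U \in X.

Definition level (i : nat) X := [set S in X | #|S| == i].

Definition chains i X := supp_space (level i X).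
Definition cycles i X := (chains i X :&: lker bdryL)%VS.
Definition bounds i X := (bdryL @: chains i.+1 X)%VS.
(** The dimension of homology as a truncated difference, meaningful when X is
    closed under taking subsets ([bounds_sub_cycles]). *)
Definition hdim i X := (\dim (cycles i X) - \dim (bounds i X))%N.
Definition hsum X := (\sum_(i < n.+1) hdim i X)%N.
Definition brank X := (\sum_(i < n.+1) \dim (bdryL @: chains i X))%N.

Lemma chainsP i X v :
  reflect (forall S, v S != 0 -> S \in X /\ #|S| = i) (v \in chains i X).
Proof.
apply: (iffP (supp_spaceP _ _)) => h S.
  move=> vS; have := contraNT (fun H => introT eqP (h S H)) vS.
  by rewrite inE => /andP[? /eqP].
by apply: contraNeq => /h [SX /eqP Si]; rewrite inE SX.
Qed.

Lemma bdry_chains i X v : down_closed X ->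
  v \in chains i.+1 X -> bdryL v \in chains i X.
Proof.
move=> dX /chainsP hv; apply/chainsP => U; rewrite bdryLE => nz.
have [j jU vj] : exists2 j, j \notin U & v (j |: U) != 0.
  apply/exists_inP; apply: contraNT nz => /exists_inPn h.
  by rewrite big1 // => j jU; move/negPn/eqP: (h j jU) => ->; rewrite mulr0.
have [jX] := hv _ vj; rewrite cardsU1 jU add1n => -[<-]; split=> //.
by apply: dX jX _; apply: subsetUr.
Qed.

Lemma bounds_sub_cycles i X : down_closed X -> (bounds i X <= cycles i X)%VS.
Proof.
move=> dX; apply/subvP => _ /memv_imgP[v hv ->]; rewrite memv_cap memv_ker.
by rewrite bdry_chains // bdryL_sq eqxx.
Qed.

Lemma sum_level X : (\sum_(i < n.+1) #|level i X| = #|X|)%N.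
Proof.
have lt S : (#|S| < n.+1)%N by rewrite ltnS -[X in (_ <= X)%N]card_ord max_card.
rewrite -[RHS]sum1_card (partition_big (fun S => Ordinal (lt S)) xpredT) //=.
apply: eq_bigr => i _; rewrite -sum1_card; apply: eq_bigl => S.
by rewrite inE -(inj_eq val_inj).
Qed.

Lemma bdry_chains0 X : (bdryL @: chains 0%N X)%VS = 0%VS.
Proof.
apply/eqP; rewrite -subv0; apply/subvP => _ /memv_imgP[v /chainsP hv ->].
rewrite memv0; apply/eqP/ffunP => U; rewrite bdryLE ffunE big1 // => j jU.
case: (eqVneq (v (j |: U)) 0) => [->|/hv[_]]; first by rewrite mulr0.
by rewrite cardsU1 jU.
Qed.

Lemma bdry_chains_gt X : (bdryL @: chains n.+1 X)%VS = 0%VS.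
Proof.
suff -> : chains n.+1 X = 0%VS by rewrite limg0.
apply/eqP; rewrite -subv0; apply/subvP => v /chainsP hv.
rewrite memv0; apply/eqP/ffunP => U; rewrite ffunE; apply/eqP.
by apply: contraT => /hv [_ E]; have := max_card (mem U); rewrite E card_ord ltnn.
Qed.

(** Reindexing the ranks by the degree of the target loses nothing: the
    boundary vanishes on the empty set, and no set has n + 1 elements. *)
Lemma brank_bounds X : brank X = (\sum_(i < n.+1) \dim (bounds i X))%N.
Proof.
rewrite /brank big_ord_recl bdry_chains0 dimv0 add0n.
by rewrite [RHS]big_ord_recr /= /bounds bdry_chains_gt dimv0 addn0.
Qed.

(** Each boundary rank is subtracted twice from the number of faces: from the
    cycles in its source and from the homology of its target. *)
Lemma hsum_brank X : down_closed X -> (hsum X + 2 * brank X = #|X|)%N.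
Proof.
move=> dX; rewrite mul2n -addnn addnA.
rewrite {1}brank_bounds /hsum /brank -!big_split /= -sum_level; apply: eq_bigr => i _.
rewrite subnK ?dimvS ?bounds_sub_cycles // -dim_supp_space.
exact: limg_ker_dim.
Qed.

(** The ranks for X and Y exceed that for the union by the dimension of the
    intersection of the two spaces of boundaries.  A chain that bounds both
    in X and in Y is supported on both families and is a cycle, so this
    intersection lies in the cycles of the intersection family. *)
Lemma brank_mayer_vietoris X Y : down_closed X -> down_closed Y ->
  (brank X + brank Y + brank (X :&: Y) <= #|X :&: Y| + brank (X :|: Y))%N.
Proof.
move=> dX dY; have dI : down_closed (X :&: Y).
  move=> S U; rewrite !inE => /andP[SX SY] US.
  by rewrite (dX _ _ SX US) (dY _ _ SY US).
have lI i : level i (X :&: Y) = level i X :&: level i Y.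
  by apply/setP=> S; rewrite !inE andbACA andbb.
have lU i : level i (X :|: Y) = level i X :|: level i Y.
  by apply/setP=> S; rewrite !inE andb_orl.
rewrite (brank_bounds (X :|: Y)).
rewrite (brank_bounds X) (brank_bounds Y) /brank -sum_level -!big_split /=.
apply: leq_sum => i _; rewrite /bounds /chains lU supp_spaceU limgD.
rewrite -dimv_sum_cap -addnA addnC leq_add2r.
rewrite -(dim_supp_space (level i (X :&: Y))) 
  -(limg_ker_dim bdryL (supp_space (level i (X :&: Y)))) leq_add2r; apply: dimvS.
apply/subvP=> v; rewrite memv_cap => /andP[vX vY]; rewrite memv_cap memv_ker.
have := subvP (bounds_sub_cycles i dX) _ vX.
have := subvP (bounds_sub_cycles i dY) _ vY.
rewrite !memv_cap memv_ker => /andP[/chainsP hY ->] /andP[/chainsP hX _].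
rewrite andbT; apply/chainsP => S vS; have [SX Si] := hX S vS.
by have [SY _] := hY S vS; rewrite inE SX SY.
Qed.

(** The inequality is that of the long exact Mayer-Vietoris sequence; the parity
    comes from inclusion-exclusion on the number of faces. *)
Lemma hsum_mayer_vietoris X Y : down_closed X -> down_closed Y ->
  (hsum (X :|: Y) <= hsum X + hsum Y + hsum (X :&: Y))%N /\
  odd (hsum (X :|: Y)) = odd (hsum X + hsum Y + hsum (X :&: Y)).
Proof.
move=> dX dY.
have dI : down_closed (X :&: Y).
  move=> S U; rewrite !inE => /andP[SX SY] US.
  by rewrite (dX _ _ SX US) (dY _ _ SY US).
have dU : down_closed (X :|: Y).
  move=> S U; rewrite !inE => /orP[SX|SY] US; first by rewrite (dX _ _ SX US).
  by rewrite (dY _ _ SY US) orbT.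
have := brank_mayer_vietoris dX dY; have := cardsUI X Y.
by rewrite -(hsum_brank dX) -(hsum_brank dY) -(hsum_brank dI) -(hsum_brank dU); lia.
Qed.

Lemma hsum_set0 : hsum set0 = 0%N.
Proof.
have d0 : down_closed set0 by move=> S U; rewrite inE.
by have := hsum_brank d0; rewrite cards0; lia.
Qed.

Lemma hsum_set1 : hsum [set set0] = 1%N.
Proof.
have d1 : down_closed [set set0] by move=> S U; rewrite !inE => /eqP ->; rewrite subset0.
by have := hsum_brank d1; rewrite cards1; lia.
Qed.

(** A cone with apex j is acyclic.  Its faces are paired by adding or deleting j,
    and the boundary is injective on the chains supported on the faces that
    contain j, since the coefficient at S :\ j only comes from S.  Hence
    the rank is at least half of the number of faces. *)
Lemma hsum_cone X j : down_closed X ->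
  (forall S, S \in X -> j |: S \in X) -> hsum X = 0%N.
Proof.
move=> dX jX.
pose Xj := [set S in X | j \in S].
have X2 : (#|X| = 2 * #|Xj|)%N.
  rewrite mul2n -addnn -(cardsID [set S : {set _} | j \in S] X) -setIdE; congr (_ + _)%N.
  rewrite -[RHS](card_in_imset (f := fun S : {set _} => S :\ j)).
    apply: eq_card => S; apply/idP/imsetP => [|[A]].
      rewrite !inE => /andP[jS SX]; exists (j |: S); last by rewrite setU1K.
      by rewrite !inE jX ?eqxx.
    by rewrite !inE => /andP[AX jA] ->; rewrite !inE eqxx /= (dX A) ?subD1set.
  move=> S A; rewrite !inE => /andP[_ jS] /andP[_ jA] E.
  by rewrite -(setD1K jS) E setD1K.
suff : (#|Xj| <= brank X)%N by have := hsum_brank dX; lia.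
rewrite -sum_level; apply: leq_sum => i _.
rewrite -dim_supp_space -/(chains i Xj).
have sXj : (chains i Xj <= chains i X)%VS.
  apply/subvP=> v /chainsP hv; apply/chainsP => S /hv[+ ->].
  by rewrite inE => /andP[].
rewrite -(@limg_dim_eq _ _ _ bdryL (chains i Xj)); first by apply: dimvS; apply: limgS.
apply/eqP; rewrite -subv0; apply/subvP => v.
rewrite memv_cap memv_ker memv0 => /andP[/chainsP hv /eqP Dv].
have v0 S : j \notin S -> v S = 0.
  by move=> jS; apply/eqP; apply: contraT => /hv[]; rewrite inE (negbTE jS) andbF.
apply/eqP/ffunP=> S; rewrite [RHS]ffunE.
have [jS|/v0//] := boolP (j \in S).
have := congr1 (fun w : schain k n => w (S :\ j)) Dv.
rewrite bdryLE ffunE (bigD1 j) ?inE ?eqxx //= big1 => [|l /andP[lS lj]].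
  rewrite addr0 setD1K // => /eqP; rewrite mulf_eq0 signr_eq0 => /eqP //.
by rewrite v0 ?mulr0 // !inE eqxx eq_sym (negbTE lj).
Qed.

End SetComplex.

(** * Monomial ideals and minimal generators *)

Section MonomialIdeals.
Variables (k : fieldType) (n : nat).
Implicit Types (I J : {mpoly k[n]} -> Prop) (G H : {fset 'X_{1..n}})
  (m g a : 'X_{1..n}) (S U : {set 'I_n}) (p : {mpoly k[n]}).

Lemma mon_genP (X : 'X_{1..n} -> Prop) p :
  mon_gen X p <-> (forall m, m \in msupp p -> exists2 g, X g & (g <= m)%MM).
Proof.
split=> [[s [sX ->]] m /msupp_sum_le /flattenP[t /mapP[u + ->]]|pX].
  rewrite mem_filter => /= us.
  rewrite (perm_mem (msuppMX _ _)) => /mapP[m' _ ->].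
  by exists u.2; [exact: sX | exact: lem_addr].
rewrite [p]mpolyE big_seq; apply: big_ind => [|p1 p2 h1 h2|m mp].
- by exists [::]; split; rewrite ?big_nil.
- have [s1 [sX1 ->]] := h1; have [s2 [sX2 ->]] := h2.
  exists (s1 ++ s2); rewrite big_cat; split=> // u.
  by rewrite mem_cat => /orP[/sX1|/sX2].
have [g Xg gm] := pX m mp; exists [:: (p@_m *: 'X_[m - g], g)]; split=> [u|].
  by rewrite inE => /eqP->.
by rewrite big_seq1 -scalerAl -mpolyXD submK.
Qed.

Lemma mon_idealP G p :
  mon_ideal G p <-> (forall m, m \in msupp p -> has (fun g => (g <= m)%MM) G).
Proof.
rewrite /mon_ideal mon_genP; split=> pG m /pG => [[g gG gm]|/hasP//].
by apply/hasP; exists g.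
Qed.

Lemma mon_idealX G m : mon_ideal G ('X_[m] : {mpoly k[n]}) <-> has (fun g => (g <= m)%MM) G.
Proof.
rewrite mon_idealP; split=> [/(_ m)|h m']; rewrite msuppX inE ?eqxx; first exact.
by move/eqP->.
Qed.

Definition antichain G := forall g g', g \in G -> g' \in G -> (g <= g')%MM -> g = g'.

(** The minimal generators described from the ideal alone; this is what makes
    them independent of the generating set. *)
Definition minimal_monomial J m :=
  J 'X_[m] /\ forall g, J 'X_[g] -> (g <= m)%MM -> g = m.

Lemma lem_antisym m1 m2 : (m1 <= m2)%MM -> (m2 <= m1)%MM -> m1 = m2.
Proof.
move=> /mnm_lepP h1 /mnm_lepP h2; apply/mnmP=> i.
by apply/eqP; rewrite eqn_leq h1 h2.
Qed.

Lemma antichain_minimal J G m : generates G J -> antichain G ->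
  m \in G <-> minimal_monomial J m.
Proof.
move=> GJ aG; split=> [mG|[/GJ/mon_idealX/hasP[g gG gm] min]].
  split=> [|g /GJ/mon_idealX/hasP[g' g'G g'g] gm].
    by apply/GJ/mon_idealX/hasP; exists m => //; apply: lepm_refl.
  apply: (lem_antisym gm).
  by rewrite -(aG g' m) // (lepm_trans g'g gm).
rewrite -(min g) //; apply/GJ/mon_idealX/hasP.
by exists g => //; apply: lepm_refl.
Qed.

(** If one generator divides another one, the latter can be discarded. *)
Lemma min_gens_antichain J G : min_gens J G -> antichain G.
Proof.
move=> [GJ minG] g g' gG g'G gg'; apply/eqP; apply: contraT => ne.
suff /minG : generates (G `\ g')%fset J.
  by move=> /(_ (fsubD1set _ _)) E; rewrite -E !inE eqxx in g'G.
move=> p; rewrite (GJ p) !mon_idealP; split=> pG m /pG /hasP[h hG hm].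
  apply/hasP; have [E|nh] := eqVneq h g'; last by exists h; rewrite // !inE nh.
  by exists g; rewrite ?inE ?ne //; apply: lepm_trans gg' _; rewrite -E.
by apply/hasP; exists h => //; move: hG; rewrite !inE => /andP[].
Qed.

Lemma min_gens_mem J G m : min_gens J G -> m \in G <-> min_generator J m.
Proof.
move=> mG; split=> [?|[H mH]]; first by exists G.
rewrite (antichain_minimal m mH.1 (min_gens_antichain mH)).
by rewrite -(antichain_minimal m mG.1 (min_gens_antichain mG)).
Qed.

Definition root_gens J (T : mvt J) : {fset 'X_{1..n}} :=
  match T with mvt_leaf m _ => [fset m]%fset | mvt_node G _ _ _ _ _ _ => G end.

Lemma root_gensP J (T : mvt J) : min_gens J (root_gens T).
Proof. by case: T. Qed.

(** The generators left after removing the pivot are still an antichain, hence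
    they are the minimal generators of the right child. *)
Lemma root_gens_right G m (T : mvt (mon_ideal (k := k) (G `\ m)%fset)) :
  antichain G -> root_gens T = (G `\ m)%fset.
Proof.
move=> aG; have mT := root_gensP T; apply/fsetP => g; apply/idP/idP.
  move=> /(antichain_minimal _ mT.1 (min_gens_antichain mT)) h.
  apply/antichain_minimal; last exact: h; first by [].
  by move=> u w /fsetD1P[_ uG] /fsetD1P[_ wG]; apply: aG.
move=> gG; apply/(antichain_minimal _ mT.1 (min_gens_antichain mT)).
apply/antichain_minimal; last exact: gG; first by [].
by move=> u w /fsetD1P[_ uG] /fsetD1P[_ wG]; apply: aG.
Qed.

(** * Counting the relevant nodes of a Mayer-Vietoris tree *)

Section Positions.
Variable a : 'X_{1..n}.

(** The count that is additive over the pivot and the children, as the bound on homology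
    requires; the number of relevant nodes is not, because a right child is
    relevant as the root of its own tree only. *)
Fixpoint pivot_count J (T : mvt J) : nat :=
  match T with
  | mvt_leaf m _ => (a == m)
  | mvt_node _ m _ _ _ Tl Tr => (a == m) + pivot_count Tl + pivot_count Tr
  end.

(** An explicit list, so that the uniqueness of a position becomes a statement
    about its size. *)
Fixpoint positions (q : nat) J (T : mvt J) : seq nat :=
  nseq (relevant q && (a \in root_gens T)) q ++
  match T with
  | mvt_leaf _ _ => [::]
  | mvt_node _ _ _ _ _ Tl Tr => positions (2 * q) Tl ++ positions (2 * q + 1) Tr
  end.

(** The second summand corrects for a root that is not relevant: the right child
    of a relevant node continues the branch on which a was already counted. *)
Lemma size_positions q J (T : mvt J) : (0 < q)%N ->
  (size (positions q T) + (~~ relevant q && (a \in root_gens T)) = pivot_count T)%N.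
Proof.
elim: T q => {J} [J m mJ|J G m mG G1 mG' Tl IHl Tr IHr] q q0 /=.
  by rewrite size_cat size_nseq inE /=; case: (relevant q); case: (a == m).
rewrite !size_cat size_nseq -(IHl (2 * q)%N) ?muln_gt0 // -(IHr (2 * q + 1)%N) ?addn1 //.
have -> : relevant (2 * q) by rewrite /relevant oddM orbT.
have -> : relevant (2 * q).+1 = false.
  by rewrite /relevant /= oddM /= orbF; case: q q0.
rewrite (root_gens_right Tr (min_gens_antichain mG)) !inE.
by case: eqP => [->|_]; rewrite ?mG'; case: (relevant q); case: (a \in G) => /=; lia.
Qed.

Lemma positionsP q r J (T : mvt J) :
  r \in positions q T <->
  relevant r /\ exists2 L, node_from q T r L & min_generator L a.
Proof.
have root (H : {fset 'X_{1..n}}) J0 q0 : min_gens J0 H ->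
    r \in nseq (relevant q0 && (a \in H)) q0 <->
    relevant r /\ (r = q0 /\ min_generator J0 a).
  move=> mH; rewrite mem_nseq lt0b; split.
    move=> /andP[/andP[rq aH] /eqP ->]; split=> //; split=> //.
    exact/(min_gens_mem _ mH).
  by move=> [rr [<- /(min_gens_mem _ mH) ->]]; rewrite rr eqxx.
elim: T q => {J} [J m mJ|J G m mG G1 mG' Tl IHl Tr IHr] q /=.
  rewrite cats0 (root _ _ _ mJ); split=> [[rr [E Ja]]|[rr [L [E ->] Ja]]].
    by split=> //; exists J.
  by [].
rewrite !mem_cat; split=> [/or3P[/(root _ _ _ mG)[rr [E Ja]]|/IHl[rr [L]]|/IHr[rr [L]]]|].
- by split=> //; exists J => //; apply: Or31.
- by move=> TL La; split=> //; exists L => //; apply: Or32.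
- by move=> TL La; split=> //; exists L => //; apply: Or33.
move=> [rr [L [[E EL]|TL|TL] La]]; apply/or3P.
- by apply/Or31/(root _ _ _ mG); rewrite -EL.
- by apply/Or32/IHl; split=> //; exists L.
- by apply/Or33/IHr; split=> //; exists L.
Qed.

(** At depth l below position q, the positions fill an interval of length 2^l. *)
Lemma positions_below q r J (T : mvt J) : r \in positions q T ->
  exists l, (q * 2 ^ l <= r < (q + 1) * 2 ^ l)%N.
Proof.
elim: T q => {J} [J m mJ|J G m mG G1 mG' Tl IHl Tr IHr] q /=.
  by rewrite cats0 mem_nseq => /andP[_ /eqP ->]; exists 0%N; lia.
rewrite !mem_cat => /or3P[|/IHl[l ?]|/IHr[l ?]].
- by rewrite mem_nseq => /andP[_ /eqP ->]; exists 0%N; lia.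
- by exists l.+1; rewrite expnS; lia.
- by exists l.+1; rewrite expnS; lia.
Qed.

(** Counting positions is counting nodes, because distinct nodes have distinct
    positions. *)
Lemma uniq_positions q J (T : mvt J) : (0 < q)%N -> uniq (positions q T).
Proof.
elim: T q => {J} [J m mJ|J G m mG G1 mG' Tl IHl Tr IHr] q q0 /=.
  by rewrite cats0; case: (_ && _).
rewrite cat_uniq cat_uniq IHl ?IHr ?muln_gt0 ?addn1 //=.
have exp_pos l : (0 < 2 ^ l)%N by rewrite expn_gt0.
apply/and3P; split; first by case: (_ && _).
  apply/hasPn => r; rewrite mem_nseq negb_and mem_cat => rlr.
  apply/orP; right; apply/eqP => E; subst r.
  by case/orP: rlr => /positions_below[l]; have := exp_pos l; nia.
rewrite andbT; apply/hasPn => r /positions_below[l' r1]; apply/negP.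
move=> /positions_below[l r2].
(* At equal depths the intervals below 2q and 2q+1 are disjoint; at different
   depths the deeper one starts beyond the end of the other, as q is positive. *)
have [ll'|l'l|E] := ltngtP l l'; last by subst l'; lia.
  have [d E] : exists d, l' = (l + d.+1)%N by exists (l' - l).-1; lia.
  by move: r1; rewrite E expnD expnS; have := exp_pos l; have := exp_pos d; nia.
have [d E] : exists d, l = (l' + d.+1)%N by exists (l - l').-1; lia.
by move: r2; rewrite E expnD expnS; have := exp_pos l'; have := exp_pos d; nia.
Qed.

Lemma pivot_count1 J (T : mvt J) :
  (exists! r, relevant r /\ exists2 L, mvt_node_at T r L & min_generator L a) ->
  pivot_count T = 1%N.
Proof.
move=> [r [/(positionsP 1) rT runiq]].
rewrite -(@size_positions 1) // addn0.
apply: (@perm_size _ _ [:: r]); apply: uniq_perm; rewrite ?uniq_positions // => q.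
rewrite inE; apply/idP/eqP => [/positionsP/runiq //|->//].
Qed.

End Positions.

(** * The family of sets of an ideal in a given multidegree *)

Section Support.
Variable a : 'X_{1..n}.

Definition expo S : 'X_{1..n} := (\sum_(j in S) U_(j))%MM.

Lemma expoE S i : expo S i = (i \in S).
Proof.
rewrite /expo mnm_sumE; under eq_bigr do rewrite mnm1E.
have [iS|iS] := boolP (i \in S); last first.
  by rewrite big1 // => j jS; case: eqP => // E; rewrite -E jS in iS.
by rewrite (bigD1 i) //= eqxx big1 // => j /andP[_ /negbTE ->].
Qed.

(** The upper Koszul simplicial complex in degree a of the ideal generated by G. *)
Definition koszul_sets (G : {fset 'X_{1..n}}) : {set {set 'I_n}} :=
  [set S | (expo S <= a)%MM & has (fun g => (g <= a - expo S)%MM) G].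

Lemma koszul_setsP J G S : generates G J ->
  S \in koszul_sets G <-> (expo S <= a)%MM /\ J 'X_[a - expo S].
Proof.
move=> GJ; rewrite inE; split=> [/andP[Sa /mon_idealX h]|[-> /GJ/mon_idealX //]].
by split=> //; apply/GJ.
Qed.

Lemma koszul_sets_down_closed G : down_closed (koszul_sets G).
Proof.
move=> S U; rewrite !inE => /andP[/mnm_lepP Sa /hasP[g gG /mnm_lepP gS]] /subsetP US.
have le i : (expo U i <= expo S i)%N.
  by rewrite !expoE; case: (boolP (i \in U)) => // /US ->.
apply/andP; split; first by apply/mnm_lepP=> i; apply: leq_trans (le i) (Sa i).
apply/hasP; exists g => //; apply/mnm_lepP=> i; apply: leq_trans (gS i) _.
by rewrite !mnmBE leq_sub2l.
Qed.

(** A face is a set S such that x^S divides x^(a - m): only the empty set if m = a,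
    none if x^m does not divide x^a, and otherwise the faces form a full simplex,
    which is a cone over any variable dividing x^(a - m). *)
Lemma hsum_principal m : hsum k (koszul_sets [fset m]%fset) = (a == m).
Proof.
have inK S : (S \in koszul_sets [fset m]%fset) = (m + expo S <= a)%MM.
  rewrite inE; apply/andP/mnm_lepP => [[/mnm_lepP Sa /hasP[g]]|h].
    rewrite inE => /eqP -> /mnm_lepP mS i; have := mS i; have := Sa i.
    by rewrite mnmBE mnmDE; lia.
  split; first by apply/mnm_lepP => i; have := h i; rewrite mnmDE; lia.
  apply/hasP; exists m; rewrite ?inE //; apply/mnm_lepP => i.
  by have := h i; rewrite mnmDE mnmBE; lia.
have [am|am] := eqVneq a m.
  suff -> : koszul_sets [fset m]%fset = [set set0] by rewrite hsum_set1.
  apply/setP=> S; rewrite inK inE am; apply/mnm_lepP/eqP => [h|-> i].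
    apply/setP=> i; have := h i; rewrite mnmDE expoE inE.
    by case: (i \in S) => //; lia.
  by rewrite mnmDE expoE inE addn0.
have [ma|ma] := boolP (m <= a)%MM; last first.
  suff -> : koszul_sets [fset m]%fset = set0 by rewrite hsum_set0.
  apply/setP=> S; rewrite inK inE; apply: contraNF ma.
  exact/lepm_trans/lem_addr.
have /existsP[j mj] : [exists j, (m j < a j)%N].
  apply: contraR am => /existsPn h; apply/eqP/mnmP => i.
  by have := h i; have := mnm_lepP ma i; lia.
apply: (@hsum_cone _ _ _ j); first exact: koszul_sets_down_closed.
move=> S; rewrite !inK => /mnm_lepP h; apply/mnm_lepP => i.
have := h i; rewrite !mnmDE !expoE !inE.
by case: (eqVneq i j) => [->|]//=; lia.
Qed.

(** Induction along the tree: a monomial lies in the left child if and only if it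
    lies both in the right child and in the ideal of the pivot, so no least
    common multiples have to be computed. *)
Lemma hsum_pivot_count J (T : mvt J) :
  (hsum k (koszul_sets (root_gens T)) <= pivot_count a T)%N /\
  odd (hsum k (koszul_sets (root_gens T))) = odd (pivot_count a T).
Proof.
elim: T => {J} [J m mJ|J G m mG G1 mG' Tl IHl Tr IHr] /=.
  by rewrite hsum_principal.
have EU : koszul_sets G = koszul_sets [fset m]%fset :|: koszul_sets (G `\ m)%fset.
  apply/setP=> S; rewrite !inE -andb_orr; congr (_ && _).
  apply/hasP/orP => [[g gG gS]|[]/hasP[g]].
  - have [E|gm] := eqVneq g m; [left|right]; apply/hasP; exists g => //.
      by rewrite E inE.
    by rewrite !inE gm.
  - by rewrite inE => /eqP -> mS; exists m.
  - by rewrite !inE => /andP[_ gG] gS; exists g.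
have EI : koszul_sets (root_gens Tl) =
    koszul_sets [fset m]%fset :&: koszul_sets (G `\ m)%fset.
  apply/setP=> S; apply/idP/idP.
    move=> /(koszul_setsP _ (root_gensP Tl).1)[Sa [/mon_idealX h1 /mon_idealX h2]].
    by rewrite !inE Sa h1 h2.
  move=> h; apply/(koszul_setsP _ (root_gensP Tl).1); move: h.
  rewrite !inE => /andP[/andP[Sa h1] /andP[_ h2]].
  by split=> //; split; apply/mon_idealX.
have := hsum_mayer_vietoris k (@koszul_sets_down_closed [fset m]%fset)
  (@koszul_sets_down_closed (G `\ m)%fset).
rewrite -EU -EI hsum_principal.
rewrite (root_gens_right Tr (min_gens_antichain mG)) in IHr.
by case: IHl IHr => [? ?] [? ?] [? ?]; lia.
Qed.

End Support.
End MonomialIdeals.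

(** * From polynomial chains to functions on sets *)

(** A basis of a complement of B in Z gives a basis of the quotient. *)
Lemma quot_dim_vspace (k : fieldType) (V : vectType k) (Z B : {vspace V}) :
  (B <= Z)%VS ->
  quot_dim (fun v => v \in Z) (fun v => v \in B) (\dim Z - \dim B).
Proof.
move=> BZ; have <- : \dim (Z :\: B) = (\dim Z - \dim B)%N.
  by rewrite -(dimv_cap_compl Z B) (capv_idPr BZ) addKn.
set W := (Z :\: B)%VS; exists (fun r => (vbasis W)`_r); split=> [r|v].
  have : (vbasis W)`_r \in W by apply: vbasis_mem; rewrite mem_nth // size_tuple.
  by apply: subvP; apply: diffvSl.
rewrite -(addv_diff_cap Z B) (capv_idPr BZ) => /memv_addP[w wW [u uB ->]].
exists [ffun r => coord (vbasis W) r w]; split=> [|c cB].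
  under eq_bigr do rewrite ffunE.
  by rewrite -coord_vbasis // addrC addKr.
have : w - \sum_(r < \dim W) c r *: (vbasis W)`_r \in (W :&: B)%VS.
  rewrite memv_cap rpredB //=; last first.
    by apply: rpred_sum => r _; apply/rpredZ/vbasis_mem; rewrite mem_nth ?size_tuple.
  by have := rpredB cB uB; rewrite addrAC addrK.
rewrite capv_diff memv0 subr_eq0 => /eqP ->; apply/ffunP => r; rewrite ffunE.
by rewrite coord_sum_free // (basis_free (vbasisP W)).
Qed.

Section Transfer.
Variables (k : fieldType) (n : nat) (a : 'X_{1..n}).
Implicit Types (S U : {set 'I_n}) (f g : kchain k n) (v w : schain k n) (m : 'X_{1..n}).

Lemma expoU1 (j : 'I_n) U : j \notin U -> expo (j |: U) = (U_(j) + expo U)%MM.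
Proof. by move=> jU; rewrite /expo big_setU1. Qed.

Lemma mcoeffXM (p : {mpoly k[n]}) m m' :
  ('X_[m'] * p)@_m = if (m' <= m)%MM then p@_(m - m') else 0.
Proof.
rewrite mulrC; case: ifP => [m'm|/negbT nm].
  by rewrite -{1}(submK m'm) addmC mcoeffMX.
apply: memN_msupp_eq0; rewrite (perm_mem (msuppMX _ _)); apply/mapP => -[u _ E].
by move: nm; rewrite E lem_addr.
Qed.

Lemma kdiffE f U :
  kdiff f U = \sum_(j | j \notin U) bsign k j U *: ('X_j * f (j |: U)).
Proof.
rewrite /kdiff sum_ffunE; under eq_bigr do rewrite sum_ffunE.
rewrite (exchange_big_dep predT) //= [RHS]big_mkcond; apply: eq_bigr => j _.
under eq_bigr do rewrite ffunE.
case: ifP => jU; last first.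
  by rewrite big1 // => S jS; case: eqP => // E; rewrite E !inE eqxx in jU.
rewrite (bigD1 (j |: U)) ?setU11 //= setU1K // eqxx big1 ?addr0 => [|S /andP[jS SU]].
  rewrite -/(bsign _ _ _) -(bsignU1_ge k U (leqnn j)) -mulrA -mul_mpolyC.
  by rewrite /bsign rmorph_sign.
case: eqP => // E; by rewrite E setD1K ?eqxx in SU.
Qed.

Lemma mcoeff_kdiff f U m :
  (kdiff f U)@_m = \sum_(j | j \notin U) bsign k j U *
     (if (U_(j) <= m)%MM then (f (j |: U))@_(m - U_(j)) else 0).
Proof.
rewrite kdiffE raddf_sum /=; apply: eq_bigr => j _.
by rewrite mcoeffZ mcoeffXM.
Qed.

(** The component of multidegree a, as a function on sets; the test is needed
    because the subtraction of exponents is truncated.  It is defined on all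
    chains, since a boundary of multidegree a may be given as the boundary of a
    chain that is not homogeneous. *)
Definition strand f : schain k n :=
  [ffun S => if (expo S <= a)%MM then (f S)@_(a - expo S) else 0].

Definition unstrand v : kchain k n := [ffun S => v S *: 'X_[a - expo S]].

Lemma strand_is_linear : linear strand.
Proof.
move=> c f g; apply/ffunP => S; rewrite !ffunE; case: ifP => _; last first.
  by rewrite scaler0 addr0.
by rewrite mcoeffD mcoeffZ.
Qed.

HB.instance Definition _ :=
  GRing.isLinear.Build k (kchain k n) (schain k n) *:%R strand strand_is_linear.

Lemma strand_kdiff f : strand (kdiff f) = bdryL k n (strand f).
Proof.
apply/ffunP => U; rewrite bdryLE ffunE; case: ifP => [/mnm_lepP Ua|/negbT Ua].
  rewrite mcoeff_kdiff; apply: eq_bigr => j jU; congr (_ * _).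
  rewrite ffunE expoU1 // [(U_(j) + _)%MM]addmC -submDA; congr (if _ then _ else _).
  apply/mnm_lepP/mnm_lepP => h i; have := h i; have := Ua i;
    by rewrite mnmBE mnmDE; lia.
rewrite big1 // => j jU; rewrite ffunE ifF ?mulr0 //; apply: contraNF Ua.
by rewrite expoU1 //; apply/lepm_trans/lem_addl.
Qed.

Lemma kmultidegP f :
  kmultideg a f <-> forall S m, (m + expo S)%MM != a -> (f S)@_m = 0.
Proof.
split=> fa S m; last by rewrite mcoeff_msupp => h; apply/eqP; apply: contraNT h => /fa ->.
by apply: contraNeq; rewrite -mcoeff_msupp => /fa/eqP.
Qed.

Lemma unstrandK f : kmultideg a f -> unstrand (strand f) = f.
Proof.
move=> /kmultidegP fa; apply/ffunP => S; rewrite !ffunE; apply/mpolyP => m.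
rewrite mcoeffZ mcoeffX; case: eqP => [<-|ne].
  rewrite mulr1; case: ifP => // /negbT nSa; rewrite fa //.
  by apply: contraNneq nSa => <-; apply: lem_addl.
rewrite mulr0 fa //; apply/eqP => E; apply: ne.
by rewrite -E addmK.
Qed.

Lemma kmultideg_kdiff f : kmultideg a f -> kmultideg a (kdiff f).
Proof.
move=> /kmultidegP fa; apply/kmultidegP => U m ma; rewrite mcoeff_kdiff.
rewrite big1 // => j jU; case: ifP => jm; rewrite ?mulr0 //.
by rewrite fa ?mulr0 // expoU1 // addmA submK.
Qed.

Lemma kmultideg_unstrand v : (forall S, v S != 0 -> (expo S <= a)%MM) ->
  kmultideg a (unstrand v).
Proof.
move=> va; apply/kmultidegP => S m mS; rewrite ffunE mcoeffZ mcoeffX.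
have [->|/va Sa] := eqVneq (v S) 0; first by rewrite mul0r.
by case: eqP => [E|]; rewrite ?mulr0 //; rewrite -E submK ?eqxx in mS.
Qed.

Lemma strandK v : (forall S, v S != 0 -> (expo S <= a)%MM) ->
  strand (unstrand v) = v.
Proof.
move=> va; apply/ffunP => S; rewrite !ffunE mcoeffZ mcoeffX eqxx mulr1.
by case: ifP => // /negP Sa; apply/esym/eqP; apply: contraT => /va.
Qed.

Variables (I : {mpoly k[n]} -> Prop) (G : {fset 'X_{1..n}}).
Hypothesis GI : generates G I.
Let X := koszul_sets a G.

Lemma strand_chains i f : koszul I i f -> strand f \in chains k i X.
Proof.
move=> If; apply/chainsP => S; rewrite ffunE inE.
have [/GI/mon_idealP fG fS] := If S; case: ifP => Sa; rewrite ?eqxx //.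
rewrite -mcoeff_msupp => mS; split; first exact: fG.
by apply/eqP; apply: contraTT mS => /fS ->; rewrite msupp0.
Qed.

Lemma chains_expo i v : v \in chains k i X -> forall S, v S != 0 -> (expo S <= a)%MM.
Proof. by move=> /chainsP vX S /vX[]; rewrite inE => /andP[]. Qed.

Lemma unstrand_koszul i v : v \in chains k i X -> koszul I i (unstrand v).
Proof.
move=> /chainsP vX S; rewrite ffunE; split.
  apply/GI/mon_idealP => m; have [->|vS] := eqVneq (v S) 0.
    by rewrite scale0r msupp0.
  move=> /msuppZ_le; rewrite msuppX inE => /eqP ->.
  by have [] := vX S vS; rewrite inE => /andP[].
have [->|/vX[_ ->]] := eqVneq (v S) 0; first by rewrite scale0r.
by rewrite eqxx.
Qed.

Lemma strand_cycles i f : kmultideg a f ->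
  kcycle I i f <-> strand f \in cycles k i X.
Proof.
move=> fa; rewrite memv_cap memv_ker -strand_kdiff; split=> [[/strand_chains -> ->]|].
  by rewrite linear0 eqxx.
move=> /andP[/unstrand_koszul]; rewrite unstrandK // => If /eqP df; split=> //.
rewrite -(unstrandK (kmultideg_kdiff fa)) df.
by apply/ffunP => S; rewrite !ffunE scale0r.
Qed.

(** If f bounds some chain, it also bounds the part of multidegree a of this chain,
    which is why taking the strand of an arbitrary primitive is enough. *)
Lemma strand_bounds i f : kmultideg a f ->
  kboundary I i f <-> strand f \in bounds k i X.
Proof.
move=> fa; split=> [[g [Ig ->]]|/memv_imgP[w wX fw]].
  by rewrite strand_kdiff memv_img // strand_chains.
exists (unstrand w); split; first exact: unstrand_koszul.
have wa := chains_expo wX.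
rewrite -(unstrandK (kmultideg_kdiff (kmultideg_unstrand wa))).
by rewrite strand_kdiff strandK // -fw unstrandK.
Qed.

Lemma koszul_homology_hdim i : koszul_homology_dim I i a (hdim k i X).
Proof.
have [b [bZ bP]] := quot_dim_vspace (bounds_sub_cycles k i (@koszul_sets_down_closed n a G)).
have bX r : b r \in chains k i X by have := bZ r; rewrite memv_cap => /andP[].
have ba r := kmultideg_unstrand (chains_expo (bX r)).
have bK r := strandK (chains_expo (bX r)).
exists (fun r => unstrand (b r)); split=> [r|f [fZ fa]].
  by split=> //; apply/strand_cycles; rewrite ?bK.
have degB (c : {ffun 'I_(hdim k i X) -> k}) :
    kmultideg a (f - \sum_(r < hdim k i X) c r *: unstrand (b r)).
  apply/kmultidegP => S m mS; rewrite !ffunE mcoeffB (kmultidegP f).1 //.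
  rewrite sum_ffunE raddf_sum big1 ?subr0 // => r _.
  by rewrite ffunE /= mcoeffZ (kmultidegP _).1 ?mulr0.
have strB (c : {ffun 'I_(hdim k i X) -> k}) :
    strand (f - \sum_(r < hdim k i X) c r *: unstrand (b r)) =
    strand f - \sum_(r < hdim k i X) c r *: b r.
  rewrite linearB linear_sum; congr (_ - _); apply: eq_bigr => r _.
  by rewrite linearZ /= bK.
have [c [cB cuniq]] := bP _ ((strand_cycles i fa).1 fZ).
exists c; split=> [|c' [/(strand_bounds i (degB c'))]].
  by split=> //; apply/strand_bounds; rewrite ?strB.
by rewrite strB => /cuniq.
Qed.

End Transfer.

Theorem proposition3p1p7 (k : fieldType) (hk : [pchar k] =i pred0) (n : nat)
    (I : {mpoly k[n]} -> Prop) (hI : monomial_ideal I) (T : mvt I)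
    (a : 'X_{1..n})
    (ha : exists! p : nat, relevant p /\
            exists2 J, mvt_node_at T p J & min_generator J a) :
  exists d : nat -> nat,
    (forall i : nat, koszul_homology_dim I i a (d i)) /\
    (\sum_(i < n.+1) d i)%N = 1%N.
Proof.
exists (fun i => hdim k i (koszul_sets a (root_gens T))); split.
  by move=> i; apply: koszul_homology_hdim; case: (root_gensP T).
have := hsum_pivot_count a T; rewrite (pivot_count1 ha) /hsum.
by case: (\sum_(i < _) _)%N => [|[|h]] [].
Qed.
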